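(* Let $(X_t)_{t\ge0}$ be an integrable stochastic process with $\mathbb{E}X_t=0$ for all $t$, such that for all $0<r<s<u$ $$\mathbb{E}\left(\left.\tfrac{X_s-X_r}{s-r}-\tfrac{X_u-X_s}{u-s}\right|\mathcal{F}_{r,u}\right)=A_{ru}X_r+B_{ru}X_u,$$ where $A_{ru}$ and $B_{ru}$ are deterministic functions of $r$ and $u$ but not of $s$. Suppose that $X_r$ and $X_s$ are linearly independent as functions on the probability space $\Omega$ for $0<r<s$. (i) If $r\mapsto A_{ru}$ is bounded on $(0,u)$ for some $u>0$, then there exist $\alpha\ge0$ and $\rho\in[0,1]$ such that for all $0\le r<s<u$ $$\mathbb{E}(X_s|\mathcal{F}_{r,u})=a_{sru}X_r+b_{sru}X_u,\qquad a_{sru}=\frac{(u-s)\,b(s,u)}{(u-r)\,b(r,u)},\quad b_{sru}=\frac{(s-r)\,b(r,s)}{(u-r)\,b(r,u)},$$ with $b(s,u)=\alpha su+\rho(s+u)+1-\rho$. (ii) If $r\mapsto A_{ru}$ is unbounded on $(0,u)$ for some $u>0$, then for all $0<r<s<u$ $$\mathbb{E}(X_s|\mathcal{F}_{r,u})=a_{sru}X_r+b_{sru}X_u,\qquad a_{sru}=\frac{s(u-s)}{r(u-r)},\quad b_{sru}=\frac{s(s-r)}{u(u-r)}.$$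
   Context: For a real-valued stochastic process $(X_t)_{t\ge0}$ on a probability space $(\Omega,\mathcal{F},\mathbb{P})$, $\mathcal{F}_{r,u}$ denotes the complete $\sigma$-field generated by $\{X_t: t\in[0,r]\cup[u,\infty)\}$, $0\le r<u$. Equalities between random variables are almost sure, and linear independence is understood for random variables modulo almost sure equality.
   Formalization: In (i), the formula at r = 0 is claimed only when the displayed regression hypothesis is also assumed at r = 0 (for all 0 < s < u); without it that instance is false, e.g. X_0 = 0 and X_t = tξ+η for t > 0. *)

(* Defs.v *)
From HB Require Import structures.
From mathcomp Require Import all_boot all_order all_algebra.
From mathcomp Require Import all_classical all_reals all_analysis.

Set Implicit Arguments.
Unset Strict Implicit.
Unset Printing Implicit Defensive.

Import Order.TTheory GRing.Theory Num.Theory.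
Import numFieldNormedType.Exports.

Local Open Scope classical_set_scope.
Local Open Scope ring_scope.

Section conditional_expectation.
Context {d : measure_display} {T : measurableType d} {R : realType}.
Variable P : probability T R.

(* Z = E(Y | G) almost surely, i.e., Z is a version of E(Y | G).  G is the set
   of events of a sub-sigma-field of the sigma-field of T.  When G contains the
   null events, this is invariant under almost sure modifications of Z. *)
Definition is_cond_expectation (G : set (set T)) (Y Z : T -> R) : Prop :=
  [/\ forall U : set R, measurable U -> G (Z @^-1` U),
      P.-integrable setT (EFin \o Z) &
      forall E, G E -> (\int[P]_(w in E) (Z w)%:E = \int[P]_(w in E) (Y w)%:E)%E].

(* Processes (X_t)_{t >= 0} are functions X : R -> T -> R, whose values at
   negative times are never used. *)

Definition past_future_events (X : R -> T -> R) (r u : R) : set (set T) :=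
  \bigcup_(t in `[0, r] `|` `[u, +oo[)
    preimage_set_system setT (X t) measurable.

Definition null_events : set (set T) := [set N | measurable N /\ P N = 0%E].

(* The complete sigma-field F_{r,u}.  If P is complete, all the subsets of null
   events are null events; in general, they are adjoined only when they are
   events, so that F_{r,u} is a sub-sigma-field of the sigma-field of T. *)
Definition past_future (X : R -> T -> R) (r u : R) : set (set T) :=
  <<s past_future_events X r u `|` null_events >>.

Definition linearly_independent (Y Z : T -> R) : Prop :=
  forall a b : R, {ae P, forall w, a * Y w + b * Z w = 0} -> a = 0 /\ b = 0.

(* The regression property at a fixed r; neither A r u nor B r u depends on s.
   The property at every r > 0 leaves X_0 unrelated to (X_t)_{t > 0}: it holds
   with A = B = 0 for X_0 = 0 and X_t = t xi + eta (t > 0), with xi and eta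
   linearly independent, centred and integrable, although
   E(X_s | F_{0,u}) = X_s is not a combination of X_0 and X_u.  A formula for
   E(X_s | F_{0,u}) in terms of X_0 and X_u thus needs the property at r = 0
   as well. *)
Definition linear_slope_regression (X : R -> T -> R) (A B : R -> R -> R)
    (r : R) : Prop :=
  forall s u, r < s -> s < u ->
    is_cond_expectation (past_future X r u)
      (fun w => (X s w - X r w) / (s - r) - (X u w - X s w) / (u - s))
      (fun w => A r u * X r w + B r u * X u w).

End conditional_expectation.

Definition harness_b {R : realType} (alpha rho s u : R) : R :=
  alpha * s * u + rho * (s + u) + 1 - rho.

(* Main.v *)
(* Solving the regression for X_s gives E(X_s | F_{r,u}) = a_sru X_r + b_sru X_u
   with a_sru = (u - s) / (u - r) (1 + A_ru (s - r)) and b_sru = (s - r) / (u - r)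
   (1 + B_ru (u - s)).  For r < s < t < u, conditioning E(X_s | F_{r,t}) and
   E(X_t | F_{s,u}) on F_{r,u} and using linear independence gives identities
   relating (A_ru, B_ru) to (A_rt, B_rt) and to (A_su, B_su).  Let
   b(s,u) = al s u + be (s + u) + ga be such that b(r,u) <> 0,
   A_ru = (al u + be) / b(r,u) and B_ru = - (al r + be) / b(r,u) for one pair
   (r, u); by these identities the same holds for every pair.  So b does not
   vanish on 0 < r < u, has constant sign there, and letting the arguments tend
   to 0 and to infinity yields al, be, ga >= 0.  If be + ga > 0, dividing b by
   be + ga gives (i) and A_.u is bounded; if be = ga = 0, then A_ru = 1 / r is
   unbounded, which is (ii).  Conditional expectations are handled through the
   integrals of X_t over the events of F_{r,u}. *)

Require Import Defs.
From HB Require Import structures.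
From mathcomp Require Import all_boot all_order all_algebra.
From mathcomp Require Import all_classical all_reals all_analysis.
From mathcomp Require Import measurable_realfun ring lra.

Set Implicit Arguments.
Unset Strict Implicit.
Unset Printing Implicit Defensive.

Import Order.TTheory GRing.Theory Num.Theory.
Import numFieldNormedType.Exports.

Local Open Scope classical_set_scope.
Local Open Scope ring_scope.

(** * The functional equations of the slopes *)

(** Reduces an equation to a known one when their differences are proportional; [field] then checks
    the proportionality. *)
Lemma eq_from_scaled (R : idomainType) (k x y l m : R) :
  k != 0 -> k * (x - y) = l - m -> l = m -> x = y.
Proof.
move=> k0 + lm; rewrite lm subrr => /eqP.
by rewrite mulf_eq0 (negPf k0) subr_eq0 => /eqP.
Qed.

Section weights.
Context {R : realType}.
Implicit Types (A B : R -> R -> R) (al be ga r s t u : R).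

(* The weights of X_r and X_u in E(X_s | F_{r,u}): the regression of the
   difference of slopes, solved for X_s. *)
Definition wl A r s u := (u - s) / (u - r) * (1 + A r u * (s - r)).
Definition wr B r s u := (s - r) / (u - r) * (1 + B r u * (u - s)).

(** In each of the four tower lemmas, one intermediate time factors out: the difference of the two
    sides is a nonzero multiple of a relation between three times only. *)
Lemma wr_tower_right B r s t u : r < s -> s < t -> t < u ->
  wr B r s u = wr B r s t * wr B r t u ->
  B r u = B r t * (1 + B r u * (u - t)).
Proof.
move=> rs st tu.
apply: (@eq_from_scaled _ ((s - r) * (t - s) / (u - r))).
  by rewrite !mulf_neq0 ?invr_eq0//; apply/eqP; lra.
by rewrite /wr; field; apply/andP; split; apply/eqP; lra.
Qed.

Lemma wl_tower_right A B r s t u : r < s -> s < t -> t < u ->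
  wl A r s u = wl A r s t + wr B r s t * wl A r t u ->
  (t - r) * A r u = (u - r) * A r t + (u - t) * B r t * (1 + A r u * (t - r)).
Proof.
move=> rs st tu.
apply: (@eq_from_scaled _ ((s - r) * (t - s) / ((u - r) * (t - r)))).
  by rewrite !mulf_neq0 ?invr_eq0 ?mulf_neq0//; apply/eqP; lra.
by rewrite /wr /wl; field; apply/andP; split; apply/eqP; lra.
Qed.

Lemma wl_tower_left A r s t u : r < s -> s < t -> t < u ->
  wl A r t u = wl A s t u * wl A r s u ->
  A r u = A s u * (1 + A r u * (s - r)).
Proof.
move=> rs st tu.
apply: (@eq_from_scaled _ ((u - t) * (t - s) / (u - r))).
  by rewrite !mulf_neq0 ?invr_eq0//; apply/eqP; lra.
by rewrite /wl; field; apply/andP; split; apply/eqP; lra.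
Qed.

Lemma wr_tower_left A B r s t u : r < s -> s < t -> t < u ->
  wr B r t u = wr B s t u + wl A s t u * wr B r s u ->
  (u - s) * B r u = (u - r) * B s u + (s - r) * A s u * (1 + B r u * (u - s)).
Proof.
move=> rs st tu.
apply: (@eq_from_scaled _ ((u - t) * (t - s) / ((u - r) * (u - s)))).
  by rewrite !mulf_neq0 ?invr_eq0 ?mulf_neq0//; apply/eqP; lra.
by rewrite /wr /wl; field; apply/andP; split; apply/eqP; lra.
Qed.

Definition bform al be ga s u : R := al * s * u + be * (s + u) + ga.

(* A r u and B r u are d/dr and - d/du of ln (bform al be ga r u). *)
Definition slopes A B al be ga r u :=
  [/\ bform al be ga r u != 0,
      A r u * bform al be ga r u = al * u + be &
      B r u * bform al be ga r u = - (al * r + be)].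

(* The hypotheses are the four identities obtained from the tower property; each
   of them moves one end point of the pair (r, u). *)
Section propagation.
Variables (A B : R -> R -> R) (al be ga : R).
Hypothesis B_right : forall r t u, 0 < r -> r < t -> t < u ->
  B r u = B r t * (1 + B r u * (u - t)).
Hypothesis A_right : forall r t u, 0 < r -> r < t -> t < u ->
  (t - r) * A r u = (u - r) * A r t + (u - t) * B r t * (1 + A r u * (t - r)).
Hypothesis A_left : forall r s u, 0 < r -> r < s -> s < u ->
  A r u = A s u * (1 + A r u * (s - r)).
Hypothesis B_left : forall r s u, 0 < r -> r < s -> s < u ->
  (u - s) * B r u = (u - r) * B s u + (s - r) * A s u * (1 + B r u * (u - s)).
Local Notation b := (bform al be ga).
Local Notation Q := (slopes A B al be ga).

(** Being inverse to each other, the two factors do not vanish; this is how [b] stays nonzero when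
    an end point moves. *)
Let cross_neq0 (x y z : R) : x = y * (1 + x * z) -> (1 + x * z) * (1 - y * z) = 1.
Proof. by move=> h; rewrite mulrBr mulr1 mulrA [_ * y]mulrC -h; ring. Qed.

(** For fixed [r], [b] is affine in its right argument with slope [al * r + be], that is
    [- B r t * b r t]. So moving from [t] to [u] multiplies [b] by [1 - B r t * (u - t)]. *)
Lemma slopes_right_up r t u : 0 < r -> r < t -> t < u -> Q r t -> Q r u.
Proof.
move=> r0 rt tu [b0 hA hB].
have hx := cross_neq0 (B_right r0 rt tu).
have eb : b r u = b r t * (1 - B r t * (u - t)).
  rewrite mulrBr mulr1 mulrA [b r t * B r t]mulrC hB /bform; ring.
have x0 : 1 - B r t * (u - t) != 0.
  by apply: contra_eq_neq hx => ->; rewrite mulr0 eq_sym oner_neq0.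
split.
- by rewrite eb mulf_neq0.
- have tr0 : t - r != 0 by apply/eqP; lra.
  apply: (mulfI tr0); rewrite eb.
  have -> : (t - r) * (A r u * (b r t * (1 - B r t * (u - t)))) =
     b r t * ((t - r) * A r u - (u - t) * B r t * (A r u * (t - r))) by ring.
  rewrite (A_right r0 rt tu).
  have -> : b r t * ((u - r) * A r t + (u - t) * B r t * (1 + A r u * (t - r)) -
      (u - t) * B r t * (A r u * (t - r))) =
    (u - r) * (A r t * b r t) + (u - t) * (B r t * b r t) by ring.
  by rewrite hA hB; ring.
- rewrite -hB (B_right r0 rt tu) eb.
  have -> : B r t * (1 + B r u * (u - t)) * (b r t * (1 - B r t * (u - t))) =
    B r t * b r t * ((1 + B r u * (u - t)) * (1 - B r t * (u - t))) by ring.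
  by rewrite hx mulr1.
Qed.

Lemma slopes_right_down r t u : 0 < r -> r < t -> t < u -> Q r u -> Q r t.
Proof.
move=> r0 rt tu [b0 hA hB].
have hx := cross_neq0 (B_right r0 rt tu).
have eb : b r t = b r u * (1 + B r u * (u - t)).
  rewrite mulrDr mulr1 mulrA [b r u * B r u]mulrC hB /bform; ring.
have x0 : 1 + B r u * (u - t) != 0.
  by apply: contra_eq_neq hx => ->; rewrite mul0r eq_sym oner_neq0.
have hB' : B r t * b r t = - (al * r + be).
  rewrite -hB (B_right r0 rt tu) eb; ring.
split=> //; first by rewrite eb mulf_neq0.
have ur0 : u - r != 0 by apply/eqP; lra.
apply: (mulfI ur0).
have eA : (u - r) * A r t = (t - r) * A r u - (u - t) * B r t * (1 + A r u * (t - r)).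
  by rewrite (A_right r0 rt tu); ring.
rewrite mulrA eA.
have -> : ((t - r) * A r u - (u - t) * B r t * (1 + A r u * (t - r))) * b r t =
  (t - r) * A r u * b r t - (u - t) * (1 + A r u * (t - r)) * (B r t * b r t) by ring.
rewrite hB'.
have -> : b r t = b r u - (u - t) * (al * r + be) by rewrite /bform; ring.
have -> : (t - r) * A r u * (b r u - (u - t) * (al * r + be)) -
  (u - t) * (1 + A r u * (t - r)) * - (al * r + be) =
  (t - r) * (A r u * b r u) + (u - t) * (al * r + be) by ring.
by rewrite hA; ring.
Qed.

(** For fixed [u], the slope of [b] in its left argument is [al * u + be], that is [A s u * b s u];
    the argument mirrors the one for the right end point. *)
Lemma slopes_left_down r s u : 0 < r -> r < s -> s < u -> Q s u -> Q r u.
Proof.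
move=> r0 rs su [b0 hA hB].
have hx := cross_neq0 (A_left r0 rs su).
have eb : b r u = b s u * (1 - A s u * (s - r)).
  rewrite mulrBr mulr1 mulrA [b s u * A s u]mulrC hA /bform; ring.
have x0 : 1 - A s u * (s - r) != 0.
  by apply: contra_eq_neq hx => ->; rewrite mulr0 eq_sym oner_neq0.
split.
- by rewrite eb mulf_neq0.
- rewrite -hA (A_left r0 rs su) eb.
  have -> : A s u * (1 + A r u * (s - r)) * (b s u * (1 - A s u * (s - r))) =
    A s u * b s u * ((1 + A r u * (s - r)) * (1 - A s u * (s - r))) by ring.
  by rewrite hx mulr1.
- have us0 : u - s != 0 by apply/eqP; lra.
  apply: (mulfI us0); rewrite eb.
  have -> : (u - s) * (B r u * (b s u * (1 - A s u * (s - r)))) =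
     b s u * ((u - s) * B r u - (s - r) * A s u * (B r u * (u - s))) by ring.
  rewrite (B_left r0 rs su).
  have -> : b s u * ((u - r) * B s u + (s - r) * A s u * (1 + B r u * (u - s)) -
      (s - r) * A s u * (B r u * (u - s))) =
    (u - r) * (B s u * b s u) + (s - r) * (A s u * b s u) by ring.
  by rewrite hA hB; ring.
Qed.

Lemma slopes_left_up r s u : 0 < r -> r < s -> s < u -> Q r u -> Q s u.
Proof.
move=> r0 rs su [b0 hA hB].
have hx := cross_neq0 (A_left r0 rs su).
have eb : b s u = b r u * (1 + A r u * (s - r)).
  rewrite mulrDr mulr1 mulrA [b r u * A r u]mulrC hA /bform; ring.
have x0 : 1 + A r u * (s - r) != 0.
  by apply: contra_eq_neq hx => ->; rewrite mul0r eq_sym oner_neq0.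
have hA' : A s u * b s u = al * u + be.
  rewrite -hA (A_left r0 rs su) eb; ring.
split=> //; first by rewrite eb mulf_neq0.
have ur0 : u - r != 0 by apply/eqP; lra.
apply: (mulfI ur0).
have eB : (u - r) * B s u = (u - s) * B r u - (s - r) * A s u * (1 + B r u * (u - s)).
  by rewrite (B_left r0 rs su); ring.
rewrite mulrA eB.
have -> : ((u - s) * B r u - (s - r) * A s u * (1 + B r u * (u - s))) * b s u =
  (u - s) * B r u * b s u - (s - r) * (1 + B r u * (u - s)) * (A s u * b s u) by ring.
rewrite hA'.
have -> : b s u = b r u + (s - r) * (al * u + be) by rewrite /bform; ring.
have -> : (u - s) * B r u * (b r u + (s - r) * (al * u + be)) -
  (s - r) * (1 + B r u * (u - s)) * (al * u + be) =
  (u - s) * (B r u * b r u) - (s - r) * (al * u + be) by ring.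
by rewrite hB; ring.
Qed.

Lemma slopes_right r t u : 0 < r -> r < t -> r < u -> Q r t -> Q r u.
Proof.
move=> r0 rt ru; case: (ltgtP t u) => [tu|ut|<-//].
- exact: slopes_right_up.
- exact: slopes_right_down.
Qed.

Lemma slopes_left r s u : 0 < r -> 0 < s -> r < u -> s < u -> Q r u -> Q s u.
Proof.
move=> r0 s0 ru su; case: (ltgtP r s) => [rs|sr|<-//].
- exact: slopes_left_up.
- exact: slopes_left_down.
Qed.

Lemma slopes_propagate r0 u0 r u :
  0 < r0 -> r0 < u0 -> 0 < r -> r < u -> Q r0 u0 -> Q r u.
Proof.
move=> r00 ru0 rpos ru Q0.
(* With [v] beyond both [u0] and [u], the pairs [(r0, u0)], [(r0, v)], [(r, v)], [(r, u)] change one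
   end point at a time and all stay ordered. *)
have [v [uv u0v]] : exists v, u < v /\ u0 < v.
  by exists (u + u0); split; lra.
apply: (@slopes_right r v) => //; first lra.
apply: (@slopes_left r0) => //; try lra.
by apply: (@slopes_right r0 u0) => //; lra.
Qed.

End propagation.

(** * Sign of the form [bform] and of its coefficients *)

Lemma affine_neq0_gt0 (m c x y : R) :
  (forall z, Num.min x y <= z <= Num.max x y -> m * z + c != 0) ->
  0 < m * x + c -> 0 < m * y + c.
Proof.
move=> nz x0; rewrite ltNge; apply/negP => y0.
have m0 : m != 0 by apply/eqP => m0; move: x0 y0; rewrite m0 !mul0r; lra.
(* A change of sign would place the root [- c / m] between [x] and [y], against the hypothesis. *)
have : m * (- c / m) + c = 0 by field.
apply/eqP; apply: nz.
have ec : c = - (- c / m) * m by field.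
move: (- c / m) ec => z ec; rewrite {c}ec in x0 y0.
have {}x0 : 0 < m * (x - z) by nra.
have {}y0 : m * (y - z) <= 0 by nra.
rewrite ge_min le_max.
have [mp|mn|mz] := ltgtP m 0; last by rewrite mz eqxx in m0.
- rewrite nmulr_rgt0// in x0; rewrite nmulr_rle0// in y0; lra.
- rewrite pmulr_rgt0// in x0; rewrite pmulr_rle0// in y0; lra.
Qed.

Lemma quad_ge0 (p q c e : R) : 0 < e ->
  (forall x, 0 < x -> x < e -> 0 <= p * x ^+ 2 + q * x + c) -> 0 <= c.
Proof.
move=> e0 h; rewrite leNgt; apply/negP => c0.
(* For [0 < x <= 1] the nonconstant part is at most [k * x], hence at most [- c / 2] once
   [x <= - c / (2 * k)]; the value is then at most [c / 2 < 0]. *)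
pose k := `|p| + `|q| + 1.
have k0 : 0 < k by rewrite /k; have := normr_ge0 p; have := normr_ge0 q; lra.
pose x := Num.min (Num.min 1 (e / 2)) (- c / (2 * k)).
have x0 : 0 < x by rewrite !lt_min ltr01 !divr_gt0 ?mulr_gt0//; lra.
have x1 : x <= 1 by rewrite !ge_min lexx.
have xe : x < e.
  by rewrite !gt_min; apply/orP; left; apply/orP; right; lra.
have xc : x * k <= - c / 2.
  have : x <= - c / (2 * k) by rewrite !ge_min lexx orbT.
  rewrite -(ler_pM2r k0); have -> // : - c / (2 * k) * k = - c / 2.
  by field; rewrite gt_eqF.
have := h _ x0 xe.
have := ler_norm p; have := ler_norm q.
rewrite /k in xc; move: (normr_ge0 p) (normr_ge0 q) => ? ? ? ?; nra.
Qed.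

Lemma quad_eq0 (p q c e : R) : 0 < e ->
  (forall x, 0 < x -> x < e -> p * x ^+ 2 + q * x + c = 0) -> c = 0.
Proof.
move=> e0 h; apply/le_anti/andP; split.
  rewrite -oppr_ge0; apply: (@quad_ge0 (- p) (- q) (- c) e) => // x x0 xe.
  by have := h _ x0 xe; lra.
by apply: (@quad_ge0 p q c e) => // x x0 xe; rewrite h.
Qed.

(** The form is affine in each argument and has no zero on ordered pairs, so its sign persists when
    one end point moves; a large right end point [v] again connects the two pairs. *)
Lemma bform_gt0 al be ga r0 u0 r u :
  0 < r0 -> r0 < u0 -> 0 < r -> r < u ->
  (forall x y, 0 < x -> x < y -> bform al be ga x y != 0) ->
  0 < bform al be ga r0 u0 -> 0 < bform al be ga r u.
Proof.
move=> r00 ru0 rpos ru nz pos.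
have eR x y : bform al be ga x y = (al * x + be) * y + (be * x + ga).
  by rewrite /bform; ring.
have eL x y : bform al be ga x y = (al * y + be) * x + (be * y + ga).
  by rewrite /bform; ring.
have right x y y' : 0 < x -> x < y -> x < y' ->
    0 < bform al be ga x y -> 0 < bform al be ga x y'.
  move=> x0 xy xy'; rewrite !eR; apply: affine_neq0_gt0 => z /andP[+ _].
  rewrite ge_min => /orP h; rewrite -eR nz//.
  by case: h; [exact: lt_le_trans|exact: lt_le_trans].
have left x x' y : 0 < x -> 0 < x' -> x < y -> x' < y ->
    0 < bform al be ga x y -> 0 < bform al be ga x' y.
  move=> x0 x'0 xy x'y; rewrite !eL; apply: affine_neq0_gt0 => z.
  rewrite ge_min le_max => /andP[/orP h1 /orP h2]; rewrite -eL nz//.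
  - by case: h1; exact: lt_le_trans.
  - by case: h2 => h2; exact: le_lt_trans h2 _.
have [v [uv u0v]] : exists v, u < v /\ u0 < v.
  by exists (u + u0); split; lra.
apply: (right r v) => //; first lra.
apply: (left r0) => //; try lra.
by apply: (right r0 u0) => //; lra.
Qed.

(** Each coefficient is, up to a positive factor, a limit of rescaled values: [al] comes from the
    pairs [(1/x, 2/x)] after multiplication by [x ^+ 2], and [ga] from [(x, 2x)], as [x] tends to
    0. *)
Lemma bform_gt0_coef al be ga :
  (forall x y, 0 < x -> x < y -> 0 < bform al be ga x y) ->
  [/\ 0 <= al, 0 <= be & 0 <= ga].
Proof.
move=> pos; split.
- apply: (@quad_ge0 (ga / 2) (be * (3 / 2)) al 1) => // x x0 x1.
  have h : 0 < x^-1 by rewrite invr_gt0.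
  have := pos x^-1 (2 * x^-1) h ltac:(lra).
  rewrite /bform => /ltW; rewrite -(pmulr_rge0 _ (exprn_gt0 2 x0)).
  have -> : x ^+ 2 * (al * x^-1 * (2 * x^-1) + be * (x^-1 + 2 * x^-1) + ga) =
    2 * (ga / 2 * x ^+ 2 + be * (3 / 2) * x + al) by field; rewrite gt_eqF.
  by rewrite pmulr_rge0.
(* Two limits in turn: the left argument tends to 0 with the right one fixed at [v^-1], then [v]
   tends to 0. *)
- apply: (@quad_ge0 0 ga be 1) => // v v0 v1.
  have h : 0 < v^-1 by rewrite invr_gt0.
  have : 0 <= be * v^-1 + ga.
    apply: (@quad_ge0 0 (al * v^-1 + be) _ v^-1) => // s s0 sv.
    by have := pos _ _ s0 sv; rewrite /bform; lra.
  rewrite -(pmulr_rge0 _ v0).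
  have -> // : v * (be * v^-1 + ga) = 0 * v ^+ 2 + ga * v + be.
  by field; rewrite gt_eqF.
- apply: (@quad_ge0 (2 * al) (be * 3) ga 1) => // x x0 x1.
  have := pos x (2 * x) x0 ltac:(lra).
  rewrite /bform => /ltW; rewrite expr2; lra.
Qed.

End weights.

(** * Integrals over the events of F_{r,u} *)

Section integrals.
Context {d : measure_display} {T : measurableType d} {R : realType}.
Variable P : probability T R.
Implicit Types (f g : T -> R) (E : set T).

Lemma integrable_lin f g (a b : R) E :
  P.-integrable E (EFin \o f) -> P.-integrable E (EFin \o g) -> measurable E ->
  P.-integrable E (EFin \o (fun w => a * f w + b * g w)).
Proof.
move=> fi gi mE.
have -> : EFin \o (fun w => a * f w + b * g w) =
    (fun w => a%:E * (EFin \o f) w)%E \+ (fun w => b%:E * (EFin \o g) w)%E.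
  by apply/funext => w /=; rewrite EFinD !EFinM.
by apply: integrableD => //; exact: integrableZl.
Qed.

Lemma Rintegral_lin f g (a b : R) E :
  P.-integrable E (EFin \o f) -> P.-integrable E (EFin \o g) -> measurable E ->
  \int[P]_(w in E) (a * f w + b * g w) =
    a * \int[P]_(w in E) f w + b * \int[P]_(w in E) g w.
Proof.
move=> fi gi mE; rewrite RintegralD// ?RintegralZl//.
- by have := integrableZl mE a fi; congr integrable; apply/funext => w /=; rewrite EFinM.
- by have := integrableZl mE b gi; congr integrable; apply/funext => w /=; rewrite EFinM.
Qed.

Lemma integral_EFin_Rintegral f E : P.-integrable E (EFin \o f) -> measurable E ->
  (\int[P]_(w in E) (f w)%:E = (\int[P]_(w in E) f w)%:E)%E.
Proof.
by move=> fi mE; rewrite /Rintegral fineK//; exact: integrable_fin_num.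
Qed.

(** Two events generated by [f] suffice: where [f >= 0] and where [f < 0], the integral of [|f|] is
    that of [f] up to sign, so [|f|] has integral 0. *)
Lemma ae_eq0_of_Rintegral f :
  P.-integrable setT (EFin \o f) ->
  (forall E, measurable E -> (exists2 U, measurable U & E = f @^-1` U) ->
    \int[P]_(w in E) f w = 0) ->
  {ae P, forall w, f w = 0}.
Proof.
move=> fi f0.
have mf : measurable_fun setT f by apply/measurable_EFinP; exact: measurable_int fi.
have part U : measurable U -> measurable (f @^-1` U) /\
    (\int[P]_(w in f @^-1` U) (f w)%:E = 0)%E.
  move=> mU; have mE : measurable (f @^-1` U) by rewrite -[X in measurable X]setTI; exact: mf.
  split => //; rewrite integral_EFin_Rintegral//; last exact: integrableS fi.
  by rewrite f0//; exists U.
have [mp ip] := part `[0, +oo[%classic (measurable_itv _).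
have [mn in0] := part `]-oo, 0[%classic (measurable_itv _).
have abs0 : (\int[P]_w `|(EFin \o f) w| = 0)%E.
  have -> : setT = f @^-1` `[0, +oo[ `|` f @^-1` `]-oo, 0[.
    apply/esym/seteqP; split => // w _ /=; rewrite !in_itv/= andbT.
    by case: leP; [left|right].
  rewrite (ge0_integral_setU _ mp mn)//=; last 2 first.
  - by do 2!apply: measurableT_comp => //; exact: measurable_funTS.
  - rewrite disj_set2E; apply/eqP; rewrite -subset0 => w /= [].
    by rewrite !in_itv/= andbT leNgt => /negP.
  have -> : (\int[P]_(w in f @^-1` `[0%R, +oo[) `|(f w)%:E| = 0)%E.
    rewrite -[RHS]ip; apply: eq_integral => w; rewrite inE/= in_itv/= andbT => h.
    by rewrite /= ger0_norm.
  have -> : (\int[P]_(w in f @^-1` `]-oo, 0%R[) `|(f w)%:E| = 0)%E.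
    have {1}-> : (0 = - 0 :> \bar R)%E by rewrite oppe0.
    rewrite -[in RHS]in0 -integralN/=; last first.
      by apply: integrable_add_def => //; exact: integrableS fi.
    apply: eq_integral => w; rewrite inE/= in_itv/= => h.
    by rewrite ltr0_norm.
  by rewrite adde0.
have /(ae_eq_integral_abs P measurableT) := abs0.
move=> /(_ (measurable_int P fi)).
by apply: filterS => w /(_ I)/= [].
Qed.

End integrals.

(** * Conditional expectations as identities between integrals *)

Section process.
Context {d : measure_display} {T : measurableType d} {R : realType}.
Variables (P : probability T R) (X : R -> T -> R).
Hypothesis Xint : forall t, 0 <= t -> P.-integrable setT (EFin \o X t).
Implicit Types (r s t u : R) (E : set T).

Let mX t : 0 <= t -> measurable_fun setT (X t).
Proof. by move=> t0; apply/measurable_EFinP; exact: measurable_int (Xint t0). Qed.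

Lemma past_future_measurable r u : 0 <= u ->
  past_future P X r u `<=` measurable.
Proof.
move=> u0; apply: smallest_sub; first exact: sigma_algebra_measurable.
move=> E [[t /= tru [U mU <-]]|[]//].
apply: mX => //; case: tru; rewrite /= in_itv/= ?andbT; first by case/andP.
exact: le_trans.
Qed.

Lemma past_futureS r u r' u' : r <= r' -> u' <= u ->
  past_future P X r u `<=` past_future P X r' u'.
Proof.
move=> rr' uu'; apply: sub_sigma_algebra2; apply: setSU => E [t /= tru XtE].
exists t => //; case: tru => /=; rewrite !in_itv/= ?andbT => h.
- by left; case/andP: h => -> /le_trans ->.
- by right; exact: le_trans h.
Qed.

Lemma past_future_lin r u (a b : R) (U : set R) : 0 <= r -> measurable U ->
  past_future P X r u ((fun w => a * X r w + b * X u w) @^-1` U).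
Proof.
move=> r0 mU.
pose G := past_future_events X r u `|` null_events P.
have mG t : t = r \/ t = u ->
    measurable_fun (setT : set (g_sigma_algebraType G)) (X t).
  move=> tru _ V mV; apply: sub_sigma_algebra; left.
  exists t; last by exists V.
  by case: tru => ->; [left|right]; rewrite /= in_itv/= lexx ?r0.
have := @measurable_funD _ (g_sigma_algebraType G) _ setT
  (fun w => a * X r w) (fun w => b * X u w).
move=> /(_ (measurable_funM (measurable_cst _) (mG r (or_introl erefl)))).
move=> /(_ (measurable_funM (measurable_cst _) (mG u (or_intror erefl)))).
by move=> /(_ measurableT U mU); rewrite setTI.
Qed.

(** A relation between conditional expectations is encoded as a relation between these numbers for
    all events [E] of the sigma-field; the tower property then reduces to an inclusion of
    sigma-fields. *)
Definition pint E t := \int[P]_(w in E) X t w.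

Let XintS t E : 0 <= t -> measurable E -> P.-integrable E (EFin \o X t).
Proof. by move=> t0 mE; apply: integrableS (Xint t0). Qed.

Lemma cond_expectation_lin r s u (a b : R) : 0 <= r -> r < s -> s < u ->
  (forall E, past_future P X r u E -> pint E s = a * pint E r + b * pint E u) ->
  is_cond_expectation P (past_future P X r u) (X s)
    (fun w => a * X r w + b * X u w).
Proof.
move=> r0 rs su h; have [s0 u0] : 0 <= s /\ 0 <= u by split; lra.
split.
- by move=> U mU; exact: past_future_lin.
- by apply: integrable_lin => //; exact: Xint.
- move=> E FE; have mE := past_future_measurable u0 FE.
  rewrite !integral_EFin_Rintegral//; try exact: XintS.
    by rewrite Rintegral_lin//; [rewrite -/(pint E s) h|exact: XintS|exact: XintS].
  by apply: integrable_lin => //; exact: XintS.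
Qed.

Lemma slope_regression_pint (A B : R -> R -> R) r s u E :
  linear_slope_regression P X A B r -> 0 <= r -> r < s -> s < u ->
  past_future P X r u E ->
  pint E s = wl A r s u * pint E r + wr B r s u * pint E u.
Proof.
move=> reg r0 rs su FE; have [s0 u0] : 0 <= s /\ 0 <= u by split; lra.
have mE := past_future_measurable u0 FE.
have [_ _ /(_ E FE)] := reg s u rs su.
have [ir is_ iu] : [/\ P.-integrable E (EFin \o X r), P.-integrable E (EFin \o X s)
  & P.-integrable E (EFin \o X u)] by split; exact: XintS.
(* The coefficient of [X s] in the difference of slopes; dividing by it solves for [X s]. *)
pose k := (s - r)^-1 + (u - s)^-1.
have -> : (fun w => ((X s w - X r w) / (s - r) - (X u w - X s w) / (u - s))%:E) =
   (fun w => (k * X s w + 1 * ((- (s - r)^-1) * X r w + (- (u - s)^-1) * X u w))%:E).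
  by apply/funext => w; congr EFin; rewrite /k; ring.
have il a b := integrable_lin a b ir iu mE.
rewrite !integral_EFin_Rintegral//; last exact: integrable_lin.
rewrite !Rintegral_lin// -!/(pint _ _) => -[].
move: (pint E r) (pint E s) (pint E u) => x y z /esym.
apply: (@eq_from_scaled _ k).
  rewrite gt_eqF// /k addr_gt0// invr_gt0; lra.
by rewrite /wl /wr /k; field; do ?[apply/andP; split]; apply/eqP; lra.
Qed.

(** The difference of the two combinations is measurable for F_{r,u}, so the events it generates are
    among the tested [E]; it vanishes almost surely and independence applies. *)
Lemma pint_independent r u (a b a' b' : R) : 0 <= r -> r < u ->
  linearly_independent P (X r) (X u) ->
  (forall E, past_future P X r u E ->
    a * pint E r + b * pint E u = a' * pint E r + b' * pint E u) ->
  a = a' /\ b = b'.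
Proof.
move=> r0 ru indep h; have u0 : 0 <= u by lra.
suff /indep [] : {ae P, forall w, (a - a') * X r w + (b - b') * X u w = 0} by split; lra.
apply: ae_eq0_of_Rintegral; first by apply: integrable_lin => //; exact: Xint.
move=> E mE [U mU eE]; rewrite Rintegral_lin//; try exact: XintS.
have FE : past_future P X r u E by rewrite eE; exact: past_future_lin.
by have := h E FE; rewrite /pint; lra.
Qed.

End process.

(** * Linear regressions *)

(** Since [bform] is affine in each argument, [1 + A r u * (s - r)] and [1 + B r u * (u - s)] are
    the ratios of its values at [(s, u)] and [(r, s)] to that at [(r, u)]. *)
Lemma slopes_weights (R : realType) (A B : R -> R -> R) (al be ga r s u : R) :
  r < u -> slopes A B al be ga r u ->
  wl A r s u = (u - s) * bform al be ga s u / ((u - r) * bform al be ga r u) /\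
  wr B r s u = (s - r) * bform al be ga r s / ((u - r) * bform al be ga r u).
Proof.
move=> ru [b0 hA hB]; have ur0 : u - r != 0 by apply/eqP; lra.
split.
- have -> : bform al be ga s u = bform al be ga r u + (s - r) * (A r u * bform al be ga r u).
    by rewrite hA /bform; ring.
  by rewrite /wl; field; rewrite b0.
- have -> : bform al be ga r s = bform al be ga r u + (u - s) * (B r u * bform al be ga r u).
    by rewrite hB /bform; ring.
  by rewrite /wr; field; rewrite b0.
Qed.

Section linear_regression.
Context {d : measure_display} {T : measurableType d} {R : realType}.
Variables (P : probability T R) (X : R -> T -> R) (A B : R -> R -> R).
Hypothesis Xint : forall t, 0 <= t -> P.-integrable setT (EFin \o X t).
Hypothesis Xreg : forall r, 0 < r -> linear_slope_regression P X A B r.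
Hypothesis Xindep :
  forall r s, 0 < r -> r < s -> linearly_independent P (X r) (X s).

Let regression r s u E : 0 < r -> r < s -> s < u -> past_future P X r u E ->
  pint P X E s = wl A r s u * pint P X E r + wr B r s u * pint P X E u.
Proof.
by move=> r0; apply: slope_regression_pint => //; [exact: Xreg|exact: ltW].
Qed.

(** Over events of F_{r,u}, which belong to F_{r,t}, the integral of [X s] is computed directly and
    through [X t]; independence of [X r] and [X u] identifies the coefficients. *)
Lemma weights_tower_right r s t u : 0 < r -> r < s -> s < t -> t < u ->
  wl A r s u = wl A r s t + wr B r s t * wl A r t u /\
  wr B r s u = wr B r s t * wr B r t u.
Proof.
move=> r0 rs st tu; have ru : r < u by lra.
apply: (pint_independent Xint (ltW r0) ru (Xindep r0 ru)) => E FE.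
have FE' : past_future P X r t E by apply: past_futureS FE => //; exact: ltW.
rewrite -(regression r0 rs (lt_trans st tu) FE) (regression r0 rs st FE').
by rewrite (regression r0 (lt_trans rs st) tu FE); ring.
Qed.

Lemma weights_tower_left r s t u : 0 < r -> r < s -> s < t -> t < u ->
  wl A r t u = wl A s t u * wl A r s u /\
  wr B r t u = wr B s t u + wl A s t u * wr B r s u.
Proof.
move=> r0 rs st tu; have ru : r < u by lra.
apply: (pint_independent Xint (ltW r0) ru (Xindep r0 ru)) => E FE.
have FE' : past_future P X s u E by apply: past_futureS FE => //; exact: ltW.
rewrite -(regression r0 (lt_trans rs st) tu FE).
rewrite (regression (lt_trans r0 rs) st tu FE').
by rewrite (regression r0 rs (lt_trans st tu) FE); ring.
Qed.

Lemma exists_slopes : exists al be ga : R,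
  [/\ 0 <= al, 0 <= be, 0 <= ga & forall r u, 0 < r -> r < u ->
    0 < bform al be ga r u /\ slopes A B al be ga r u].
Proof.
(* [al], [be], [ga] solve [slopes A B al be ga 1 2] with [bform al be ga 1 2 = 1]. *)
pose al := A 1 2 + B 1 2.
pose be := A 1 2 - al * 2.
pose ga := 1 - al * 2 - be * 3.
have b1 : bform al be ga 1 2 = 1 by rewrite /bform /ga; ring.
have Q0 : slopes A B al be ga 1 2.
  by split; rewrite b1 ?oner_neq0// mulr1 /be /al; ring.
have Q r u : 0 < r -> r < u -> slopes A B al be ga r u.
  move=> r0 ru; apply: (@slopes_propagate _ A B al be ga _ _ _ _ 1 2) => //; last lra.
  - move=> r' t u' r'0 rt tu.
    (* Any auxiliary time will do, as it drops out of the resulting identity. *)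
    have [s [rs st]] : exists s, r' < s /\ s < t by exists ((r' + t) / 2); split; lra.
    exact: wr_tower_right rs st tu (weights_tower_right r'0 rs st tu).2.
  - move=> r' t u' r'0 rt tu.
    have [s [rs st]] : exists s, r' < s /\ s < t by exists ((r' + t) / 2); split; lra.
    exact: wl_tower_right rs st tu (weights_tower_right r'0 rs st tu).1.
  - move=> r' s u' r'0 rs su.
    have [t [st tu]] : exists t, s < t /\ t < u' by exists ((s + u') / 2); split; lra.
    exact: wl_tower_left rs st tu (weights_tower_left r'0 rs st tu).1.
  - move=> r' s u' r'0 rs su.
    have [t [st tu]] : exists t, s < t /\ t < u' by exists ((s + u') / 2); split; lra.
    exact: wr_tower_left rs st tu (weights_tower_left r'0 rs st tu).2.
have pos r u : 0 < r -> r < u -> 0 < bform al be ga r u.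
  move=> r0 ru; apply: (@bform_gt0 _ _ _ _ 1 2) => //; [lra| |by rewrite b1].
  by move=> x y x0 xy; have [] := Q _ _ x0 xy.
have [al0 be0 ga0] := bform_gt0_coef pos.
by exists al, be, ga; split=> // r u r0 ru; split; [exact: pos|exact: Q].
Qed.

Lemma cond_expectation_bform al be ga r s u :
  slopes A B al be ga r u -> 0 < r -> r < s -> s < u ->
  is_cond_expectation P (past_future P X r u) (X s)
    (fun w =>
       (u - s) * bform al be ga s u / ((u - r) * bform al be ga r u) * X r w +
       (s - r) * bform al be ga r s / ((u - r) * bform al be ga r u) * X u w).
Proof.
move=> Q r0 rs su; have [<- <-] := slopes_weights s (lt_trans rs su) Q.
by apply: cond_expectation_lin => //; [exact: ltW|move=> E; exact: regression].
Qed.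

(* No independence of X_0 and X_u is available: the formula at r = 0 is the
   constant coefficient of a polynomial identity in r, obtained by conditioning
   the formula at 0 < r < s on F_{0,u}. *)
Lemma cond_expectation_bform0 al be ga s u :
  linear_slope_regression P X A B 0 ->
  (forall r, 0 < r -> r < u ->
    0 < bform al be ga r u /\ slopes A B al be ga r u) ->
  0 < bform al be ga 0 u -> 0 < s -> s < u ->
  is_cond_expectation P (past_future P X 0 u) (X s)
    (fun w =>
       (u - s) * bform al be ga s u / ((u - 0) * bform al be ga 0 u) * X 0 w +
       (s - 0) * bform al be ga 0 s / ((u - 0) * bform al be ga 0 u) * X u w).
Proof.
move=> reg0 Q b0u s0 su; have u0 : 0 < u := lt_trans s0 su.
apply: cond_expectation_lin => // E FE.
set b := bform al be ga.
set Is := pint P X E s; set I0 := pint P X E 0; set Iu := pint P X E u.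
(* The formula at [r], multiplied by [(u - r) * b r u] and with the integral of [X r] expressed by
   [I0] and [Iu], is quadratic in [r]; the first two arguments of [quad_eq0] are its coefficients of
   [r ^+ 2] and [r]. *)
have c0 : (u - s) * b s u * I0 + s * b 0 s * Iu - u * b 0 u * Is = 0.
  apply: (@quad_eq0 _
    ((u - s) * b s u * (- (A 0 u / u) * I0 - B 0 u / u * Iu) -
       (al * s + be) * Iu + (al * u + be) * Is)
    ((u - s) * b s u * ((A 0 u - u^-1) * I0 + (u^-1 + B 0 u) * Iu) +
       (s * (al * s + be) - b 0 s) * Iu - (u * (al * u + be) - b 0 u) * Is)
    _ s) => // r r0 rs.
  have ru : r < u := lt_trans rs su.
  have [bpos Qr] := Q _ r0 ru.
  have FE' : past_future P X r u E by apply: past_futureS FE => //; exact: ltW.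
  have := regression r0 rs su FE'.
  rewrite (slope_regression_pint Xint reg0 (lexx 0) r0 ru FE).
  have [-> ->] := slopes_weights s ru Qr.
  rewrite -/Is -/I0 -/Iu -/b.
  have ur0 : u - r != 0 by rewrite gt_eqF// subr_gt0.
  have bn0 : b r u != 0 by rewrite gt_eqF.
  move=> ->; move: bn0; rewrite /wl /wr /b /bform => bn0.
  by field; rewrite bn0 ur0 gt_eqF.
have k0 : (u - 0) * b 0 u != 0 by rewrite mulf_neq0 ?gt_eqF// subr_gt0.
have un0 : u != 0 by rewrite gt_eqF.
have bn0 : b 0 u != 0 by rewrite gt_eqF.
have := c0; apply: (@eq_from_scaled _ (- (u * b 0 u))).
  by rewrite oppr_eq0 mulf_neq0.
by field; rewrite bn0.
Qed.

End linear_regression.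

(** * Boundedness of the slope [A] near 0 *)

Lemma bounded_slope (R : realType) (A B : R -> R -> R) (al be ga u : R) :
  0 <= al -> 0 <= be -> 0 <= ga -> 0 < u -> 0 < be + ga ->
  (forall r, 0 < r -> r < u -> slopes A B al be ga r u) ->
  [bounded A r u | r in `]0, u[].
Proof.
move=> al0 be0 ga0 u0 bg Q; pose m := be * u + ga.
have m0 : 0 < m by rewrite /m; nra.
exists ((al * u + be) / m); split; first exact: num_real.
move=> M hM r; rewrite /= in_itv/= => /andP[r0 ru].
have [bn0 hA _] := Q _ r0 ru.
have mb : m <= bform al be ga r u.
  by rewrite /m /bform; have := mulr_ge0 (mulr_ge0 al0 (ltW r0)) (ltW u0); nra.
have b0 : 0 < bform al be ga r u := lt_le_trans m0 mb.
have -> : A r u = (al * u + be) / bform al be ga r u by rewrite -hA mulfK.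
have n0 : 0 <= al * u + be by nra.
rewrite ger0_norm; last exact: divr_ge0 n0 (ltW b0).
by apply: le_trans (ltW hM); rewrite ler_wpM2l// lef_pV2.
Qed.

Lemma unbounded_slope (R : realType) (A B : R -> R -> R) (al u : R) :
  0 < u -> (forall r, 0 < r -> r < u -> slopes A B al 0 0 r u) ->
  ~ [bounded A r u | r in `]0, u[].
Proof.
move=> u0 Q [M [_ hM]].
(* Here [A r u] is [r^-1]; boundedness only provides bounds strictly above [M], hence [M + 1]. *)
have h r : 0 < r -> r < u -> r^-1 <= M + 1.
  move=> r0 ru; have [bn0 hA _] := Q r r0 ru.
  have := hM (M + 1); rewrite ltrDl ltr01 => /(_ isT r).
  rewrite /= in_itv/= r0 ru => /(_ isT); apply: le_trans.
  suff <- : A r u = r^-1 by exact: ler_norm.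
  apply: (mulIf bn0); rewrite hA /bform.
  by field; rewrite gt_eqF.
have M0 : 0 < M + 1.
  by apply: (lt_le_trans _ (h (u / 2) _ _)); rewrite ?invr_gt0 ?divr_gt0//; lra.
pose r := Num.min (u / 2) ((M + 2)^-1).
have r0 : 0 < r by rewrite lt_min divr_gt0//= invr_gt0; lra.
have ru : r < u by rewrite gt_min; apply/orP; left; lra.
have : M + 2 <= r^-1.
  by rewrite -[leLHS]invrK lef_pV2 ?posrE ?invr_gt0// ?ge_min ?lexx ?orbT//; lra.
by have := h r r0 ru; lra.
Qed.


Theorem theorem4p2 (d : measure_display) (T : measurableType d) (R : realType)
    (P : probability T R) (X : R -> T -> R) (A B : R -> R -> R)
    (Xint : forall t, 0 <= t -> P.-integrable setT (EFin \o X t))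
    (Xcentered : forall t, 0 <= t -> ('E_P[X t] = 0)%E)
    (Xreg : forall r, 0 < r -> linear_slope_regression P X A B r)
    (Xindep : forall r s, 0 < r -> r < s -> linearly_independent P (X r) (X s)) :
  ((exists2 u, 0 < u & [bounded A r u | r in `]0, u[]) ->
    exists alpha rho : R, [/\ 0 <= alpha, 0 <= rho, rho <= 1 &
      forall r s u, 0 <= r -> r < s -> s < u ->
        (r = 0 -> linear_slope_regression P X A B 0) ->
        is_cond_expectation P (past_future P X r u) (X s)
          (fun w =>
             (u - s) * harness_b alpha rho s u
               / ((u - r) * harness_b alpha rho r u) * X r w +
             (s - r) * harness_b alpha rho r s
               / ((u - r) * harness_b alpha rho r u) * X u w)]) /\
  ((exists2 u, 0 < u & ~ [bounded A r u | r in `]0, u[]) ->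
    forall r s u, 0 < r -> r < s -> s < u ->
      is_cond_expectation P (past_future P X r u) (X s)
        (fun w =>
           s * (u - s) / (r * (u - r)) * X r w +
           s * (s - r) / (u * (u - r)) * X u w)).
Proof.
have [al [be [ga [al0 be0 ga0 Q]]]] := exists_slopes Xint Xreg Xindep.
have Qs u r : 0 < r -> r < u -> slopes A B al be ga r u by move=> r0 ru; have [] := Q r u r0 ru.
split=> -[v v0 hv].
(* Otherwise both coefficients vanish, being nonnegative, and the slope is unbounded. *)
- have bg : 0 < be + ga.
    rewrite lt0r addr_ge0// andbT paddr_eq0//; apply/negP => /andP[/eqP e1 /eqP e2].
    move: hv; apply: (@unbounded_slope _ A B al v v0) => r r0 rv.
    by have := Qs v r r0 rv; rewrite e1 e2.
  (* This normalisation makes [1 - rho] equal to [ga / (be + ga)]; the common factor cancels in the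
     weights. *)
  exists (al / (be + ga)), (be / (be + ga)).
  have eb x y : harness_b (al / (be + ga)) (be / (be + ga)) x y =
      bform al be ga x y / (be + ga).
    by rewrite /harness_b /bform; field; rewrite gt_eqF.
  split; [exact: divr_ge0 (ltW bg)|exact: divr_ge0 (ltW bg)| |].
    by rewrite ler_pdivrMr// mul1r lerDl.
  move=> r s u; rewrite le_eqVlt => /orP rpos rs su reg0.
  have ratio x y z : x * (y / (be + ga)) / ((u - r) * (z / (be + ga))) =
      x * y / ((u - r) * z).
    by rewrite !mulrA -mulf_div divff ?mulr1// invr_eq0 gt_eqF.
  rewrite !eb !ratio; case: rpos => [/eqP r0|r0]; last first.
    exact: (cond_expectation_bform Xint Xreg (Qs u r r0 (lt_trans rs su)) r0 rs su).
  rewrite -{r}r0 in rs reg0 ratio *.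
  apply: (cond_expectation_bform0 Xint Xreg (reg0 erefl) _ _ rs su).
    by move=> r r0 ru; exact: Q.
  by rewrite /bform mulr0 mul0r !add0r; have := lt_trans rs su; nra.
- have [be00 ga00] : be = 0 /\ ga = 0.
    suff : be + ga <= 0 by split; lra.
    rewrite leNgt; apply/negP => bg; apply: hv.
    exact: (bounded_slope al0 be0 ga0 v0 bg (Qs v)).
  move=> r s u r0 rs su; have [bp Qr] := Q r u r0 (lt_trans rs su).
  move: bp; have := cond_expectation_bform Xint Xreg Qr r0 rs su.
  rewrite /bform be00 ga00 !mul0r !addr0 => + arp.
  (* The form is now [al * r * u], so [al] is nonzero and cancels in the weights. *)
  have al_neq0 : al != 0 by apply: contraTneq arp => ->; rewrite !mul0r ltxx.
  have [r_neq0 u_neq0 ur_neq0] : [/\ r != 0, u != 0 & u - r != 0].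
    by split; apply/eqP; lra.
  congr is_cond_expectation; apply/funext => w; congr (_ * _ + _ * _);
    by field; rewrite r_neq0 u_neq0 ur_neq0 al_neq0.
Qed.
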